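(* Let $t_1,t_2\in\mathbb{R}$, let $\delta_1,\delta_2>0$, and let $\sigma:\mathbb{N}\to\mathbb{N}$ be a bijection. Let $s\in\mathbb{C}$ with $\operatorname{Re}s>1$ and assume $$\zeta(s+i(t_1+\delta_1 n))=\zeta(s+i(t_2+\delta_2\sigma(n)))\qquad\text{for } n=1,2,\ldots.$$ Then either $t_1=t_2$, $\delta_1=\delta_2$ and $\sigma=\mathrm{id}$, or $\operatorname{Re}s\le b$, where $b=b(t_1,t_2,\delta_1,\delta_2,\sigma)$ is the constant defined below.
   Context: $\zeta$ denotes the Riemann zeta-function, $\zeta(s)=\sum_{m\ge1}m^{-s}$ for $\operatorname{Re}s>1$. For $n,m\in\mathbb{N}$ put $\phi_n(m)=m^{-i(t_1+\delta_1 n)}-m^{-i(t_2+\delta_2\sigma(n))}$. For each $n$ such that $\phi_n(m)\neq0$ for some $m$, let $\mu_n=\min\{m\in\mathbb{N}:\phi_n(m)\neq0\}$ and $b_n=1+\frac{2\mu_n}{|\phi_n(\mu_n)|}$. Then $b:=\inf\{b_n : n\in\mathbb{N},\ \phi_n(m)\ne 0\text{ for some }m\}$ (with $\inf\emptyset=+\infty$). *)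

(* Defs.v *)
From Stdlib Require Import Reals Lra Lia PArith FinFun.
From Coquelicot Require Import Coquelicot.
Open Scope R_scope.

(* The index set N = {1, 2, ...} is the type [positive]. *)
Definition posR (m : positive) : R := IZR (Z.pos m).

Definition Cexp (z : C) : C :=
  (exp (Re z) * cos (Im z), exp (Re z) * sin (Im z)).

(* m^z = exp (z log m), with the real logarithm of m. *)
Definition pos_Cpow (m : positive) (z : C) : C :=
  Cexp (Cmult z (RtoC (ln (posR m)))).

Definition zeta_term (s : C) (k : nat) : C :=
  pos_Cpow (Pos.of_succ_nat k) (Copp s).

(* Meaningful for Re s > 1 only; there [zeta_is_series] below identifies it
   with the sum, in C, of the Dirichlet series. *)
Definition zeta (s : C) : C :=
  (Series (fun k => Re (zeta_term s k)), Series (fun k => Im (zeta_term s k))).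

Definition phi (t1 t2 d1 d2 : R) (sigma : positive -> positive)
    (n m : positive) : C :=
  Cminus (pos_Cpow m (Copp (Cmult Ci (RtoC (t1 + d1 * posR n)))))
         (pos_Cpow m (Copp (Cmult Ci (RtoC (t2 + d2 * posR (sigma n)))))).

Definition is_mu (f : positive -> C) (mu : positive) : Prop :=
  f mu <> RtoC 0 /\
  forall m : positive, f m <> RtoC 0 -> (mu <= m)%positive.

Definition b_set (t1 t2 d1 d2 : R) (sigma : positive -> positive)
    (x : R) : Prop :=
  exists n mu : positive,
    is_mu (phi t1 t2 d1 d2 sigma n) mu /\
    x = 1 + 2 * posR mu / Cmod (phi t1 t2 d1 d2 sigma n mu).

(* [Glb_Rbar] of the empty set is [p_infty]. *)
Definition b_const (t1 t2 d1 d2 : R) (sigma : positive -> positive) : Rbar :=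
  Glb_Rbar (b_set t1 t2 d1 d2 sigma).

Lemma Cmod_Cexp (z : C) : Cmod (Cexp z) = exp (Re z).
Proof.
unfold Cmod, Cexp; simpl fst; simpl snd.
replace (_ + _) with (exp (Re z) ^ 2).
- apply sqrt_pow2; left; apply exp_pos.
- assert (H := sin2_cos2 (Im z)); unfold Rsqr in H; nra.
Qed.

Lemma posR_of_succ_nat (k : nat) : posR (Pos.of_succ_nat k) = INR k + 1.
Proof.
unfold posR; rewrite <- S_INR, INR_IZR_INZ.
f_equal; lia.
Qed.

Lemma Cmod_zeta_term (s : C) (k : nat) :
  Cmod (zeta_term s k) = Rpower (INR k + 1) (- Re s).
Proof.
unfold zeta_term, pos_Cpow; rewrite Cmod_Cexp, posR_of_succ_nat.
destruct s as [x y]; unfold Rpower; f_equal.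
unfold Re, Cmult, Copp, RtoC; cbn [fst snd]; ring.
Qed.

Lemma Rpower_telescope (p x : R) : 0 < p -> 1 < x ->
  p * Rpower x (- (p + 1)) <= Rpower (x - 1) (- p) - Rpower x (- p).
Proof.
intros Hp Hx.
assert (E1 : Rpower x (- (p + 1)) = Rpower x (- p) * / x).
{ replace (- (p + 1)) with (- p + - (1)) by ring.
  rewrite Rpower_plus, (Rpower_Ropp x 1), Rpower_1; lra. }
assert (E2 : Rpower (x - 1) (- p)
             = Rpower x (- p) * exp (p * (ln x - ln (x - 1)))).
{ unfold Rpower; rewrite <- exp_plus; f_equal; ring. }
assert (L : / x <= ln x - ln (x - 1)).
{ assert (H : ln ((x - 1) * / x) <= (x - 1) * / x - 1).
  { assert (P : 0 < (x - 1) * / x)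
      by (apply Rmult_lt_0_compat; [| apply Rinv_0_lt_compat]; lra).
    generalize (exp_ineq1_le (ln ((x - 1) * / x))); rewrite exp_ln by exact P.
    lra. }
  rewrite ln_mult, ln_Rinv in H; try lra.
  - replace ((x - 1) * / x - 1) with (- / x) in H by (field; lra); lra.
  - apply Rinv_0_lt_compat; lra. }
assert (H := exp_ineq1_le (p * (ln x - ln (x - 1)))).
assert (P : 0 < Rpower x (- p)) by apply exp_pos.
rewrite E1, E2.
assert (p * / x <= exp (p * (ln x - ln (x - 1))) - 1) by nra.
nra.
Qed.

Lemma ex_series_pseries (a : R) : 1 < a ->
  ex_series (fun k => Rpower (INR k + 1) (- a)).
Proof.
intros Ha.
set (u := fun k => Rpower (INR k + 1) (- a)).
assert (B : forall n,
  sum_n u n <= 1 + / (a - 1) * (1 - Rpower (INR n + 1) (- (a - 1)))).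
{ induction n as [|n IH].
  - rewrite sum_O; unfold u, Rpower; simpl.
    rewrite Rplus_0_l, ln_1, !Rmult_0_r, exp_0; lra.
  - rewrite sum_Sn; unfold plus; simpl plus; cbn -[INR sum_n].
    assert (T := Rpower_telescope (a - 1) (INR (S n) + 1)).
    assert (0 <= INR n) by apply pos_INR.
    rewrite S_INR in *.
    replace (INR n + 1 + 1 - 1) with (INR n + 1) in T by ring.
    replace (- (a - 1 + 1)) with (- a) in T by ring.
    specialize (T ltac:(lra) ltac:(lra)).
    unfold u at 2; rewrite S_INR.
    assert (Q : Rpower (INR n + 1 + 1) (- a) <=
      / (a - 1) * (Rpower (INR n + 1) (- (a - 1))
                   - Rpower (INR n + 1 + 1) (- (a - 1)))).
    { apply Rmult_le_reg_l with (a - 1); [lra|].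
      rewrite <- Rmult_assoc, Rinv_r, Rmult_1_l by lra; exact T. }
    lra. }
destruct (ex_finite_lim_seq_incr (sum_n u) (1 + / (a - 1))) as [l Hl].
- intros n; rewrite sum_Sn; unfold plus; cbn -[INR sum_n].
  assert (0 < u (S n)) by apply exp_pos; lra.
- intros n; eapply Rle_trans; [apply B|].
  assert (0 < Rpower (INR n + 1) (- (a - 1))) by apply exp_pos.
  assert (0 < / (a - 1)) by (apply Rinv_0_lt_compat; lra).
  nra.
- exists l; exact Hl.
Qed.

Lemma sum_n_C (f : nat -> C) (n : nat) :
  sum_n f n = (sum_n (fun k => Re (f k)) n, sum_n (fun k => Im (f k)) n).
Proof.
induction n as [|n IH].
- rewrite !sum_O; apply surjective_pairing.
- rewrite !sum_Sn, IH; reflexivity.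
Qed.

Lemma zeta_is_series (s : C) : 1 < Re s ->
  is_series (zeta_term s : nat -> C_NormedModule) (zeta s).
Proof.
intros Hs.
assert (HP := ex_series_pseries (Re s) Hs).
assert (HR : is_series (fun k => Re (zeta_term s k)) (fst (zeta s))).
{ apply Series_correct.
  apply (@ex_series_le R_AbsRing R_CompleteNormedModule _ _) with (2 := HP).
  intros k; rewrite <- Cmod_zeta_term.
  eapply Rle_trans; [apply Rmax_l | apply Rmax_Cmod]. }
assert (HI : is_series (fun k => Im (zeta_term s k)) (snd (zeta s))).
{ apply Series_correct.
  apply (@ex_series_le R_AbsRing R_CompleteNormedModule _ _) with (2 := HP).
  intros k; rewrite <- Cmod_zeta_term.
  eapply Rle_trans; [apply Rmax_r | apply Rmax_Cmod]. }
intros P [eps HPeps].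
assert (H1 := proj1 (filterlim_locally _ _) HR eps).
assert (H2 := proj1 (filterlim_locally _ _) HI eps).
generalize (filter_and _ _ H1 H2).
unfold filtermap; apply filter_imp; intros n [Ha Hb].
apply HPeps.
change (sum_n (zeta_term s : nat -> C_NormedModule) n)
  with (sum_n (zeta_term s) n).
rewrite sum_n_C; split; assumption.
Qed.

(* Main.v *)
Require Import Defs.
From Stdlib Require Import Reals PArith FinFun Lra Lia.
From Coquelicot Require Import Coquelicot.
Open Scope R_scope.

(** Put [a = Re s].  For each [n] the hypothesis says that the Dirichlet series
    [sum_m phi_n(m) m^(-s)] vanishes.  Its first nonzero term, of modulus
    [|phi_n(mu)| mu^(-a)], is therefore at most the tail
    [2 sum_(m > mu) m^(-a) <= 2 mu^(1-a) / (a-1)], which rearranges to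
    [a <= b_n].  So [Re s <= b] holds in every case, with [b = +oo] when all
    the [phi_n] vanish identically. *)

Lemma Cexp_plus (z w : C) : Cexp (Cplus z w) = Cmult (Cexp z) (Cexp w).
Proof.
destruct z as [x y], w as [u v]; unfold Cexp, Cplus, Cmult, Re, Im; cbn [fst snd].
rewrite exp_plus, cos_plus, sin_plus; f_equal; ring.
Qed.

Lemma pos_Cpow_plus (m : positive) (z w : C) :
  pos_Cpow m (Cplus z w) = Cmult (pos_Cpow m z) (pos_Cpow m w).
Proof.
unfold pos_Cpow; rewrite <- Cexp_plus; f_equal; ring.
Qed.

Lemma Re_plus_Ci (s : C) (t : R) : Re (Cplus s (Cmult Ci (RtoC t))) = Re s.
Proof.
destruct s; unfold Re, Cplus, Cmult, Ci, RtoC; cbn [fst snd]; ring.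
Qed.

Lemma sum_n_leading_zeros (D : nat -> C_NormedModule) (k : nat) :
  (forall j, (j < k)%nat -> D j = zero) -> sum_n D k = D k.
Proof.
intros H; destruct k as [|k].
- apply sum_O.
- rewrite sum_Sn, (sum_n_ext_loc _ (fun _ => zero)) by (intros j Hj; apply H; lia).
  replace (sum_n (fun _ => zero) k) with (zero : C_NormedModule).
  + apply plus_zero_l.
  + clear H; induction k as [|k IH].
    * now rewrite sum_O.
    * now rewrite sum_Sn, <- IH, plus_zero_l.
Qed.

Section LeadingTerm.

Variables (D : nat -> C_NormedModule) (a c : R) (k0 : nat).
Hypothesis a_gt1 : 1 < a.
Hypothesis c_ge0 : 0 <= c.
Hypothesis D_bound : forall k, Cmod (D k) <= c * Rpower (INR k + 1) (- a).
Hypothesis D_zeros : forall k, (k < k0)%nat -> D k = zero.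

(** Induction on [j]: [Rpower_telescope] with exponent [a - 1] dominates each new term by a
    telescoping difference. Keeping the subtracted endpoint on the right is what lets the induction
    close. *)
Lemma tail_bound (j : nat) :
  Cmod (Cminus (sum_n D (k0 + j)) (D k0)) <=
  c / (a - 1) * (Rpower (INR k0 + 1) (- (a - 1))
                 - Rpower (INR (k0 + j) + 1) (- (a - 1))).
Proof.
induction j as [|j IH].
- rewrite Nat.add_0_r, sum_n_leading_zeros by exact D_zeros.
  replace (Cminus (D k0) (D k0)) with (RtoC 0) by ring.
  rewrite Cmod_0; lra.
- rewrite Nat.add_succ_r, sum_Sn.
  replace (Cminus (plus (sum_n D (k0 + j)) (D (S (k0 + j)))) (D k0))
    with (Cplus (Cminus (sum_n D (k0 + j)) (D k0)) (D (S (k0 + j))))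
    by (change plus with Cplus; ring).
  eapply Rle_trans; [apply Cmod_triangle|].
  assert (B := D_bound (S (k0 + j))).
  assert (T := Rpower_telescope (a - 1) (INR (S (k0 + j)) + 1)).
  assert (P := pos_INR (k0 + j)).
  rewrite S_INR in *.
  replace (INR (k0 + j) + 1 + 1 - 1) with (INR (k0 + j) + 1) in T by ring.
  replace (- (a - 1 + 1)) with (- a) in T by ring.
  specialize (T ltac:(lra) ltac:(lra)).
  set (X := Rpower (INR k0 + 1) (- (a - 1))) in *.
  set (Y := Rpower (INR (k0 + j) + 1) (- (a - 1))) in *.
  set (Z := Rpower (INR (k0 + j) + 1 + 1) (- (a - 1))) in *.
  set (W := Rpower (INR (k0 + j) + 1 + 1) (- a)) in *.
  assert (Q : c * W <= c / (a - 1) * (Y - Z)).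
  { replace (c * W) with (c / (a - 1) * ((a - 1) * W)) by (field; lra).
    apply Rmult_le_compat_l; [|exact T].
    apply Rmult_le_pos; [exact c_ge0 | left; apply Rinv_0_lt_compat; lra]. }
  lra.
Qed.

(** The partial sums tend to zero, so up to [eps] the first nonzero term is cancelled by the tail,
    and [tail_bound] controls the tail uniformly in its length. *)
Lemma leading_term_le :
  is_series D zero ->
  Cmod (D k0) <= c / (a - 1) * Rpower (INR k0 + 1) (- (a - 1)).
Proof.
intros HD; apply le_epsilon; intros eps Heps.
assert (H := proj1 (filterlim_locally_ball_norm _ _) HD (mkposreal eps Heps)).
destruct H as [N HN].
(* The index [k0 + N] is at least [N] and has the shape that [tail_bound] expects. *)
specialize (HN (k0 + N)%nat ltac:(lia)).
assert (HS : Cmod (sum_n D (k0 + N)) < eps).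
{ rewrite <- (minus_zero_r (sum_n D (k0 + N))); exact HN. }
assert (T := tail_bound N).
assert (P : 0 < Rpower (INR (k0 + N) + 1) (- (a - 1))) by apply exp_pos.
assert (Q : 0 <= c / (a - 1))
  by (apply Rmult_le_pos; [exact c_ge0 | left; apply Rinv_0_lt_compat; lra]).
assert (E : Cmod (D k0) <= Cmod (sum_n D (k0 + N))
                           + Cmod (Cminus (sum_n D (k0 + N)) (D k0))).
{ rewrite <- (Cmod_opp (Cminus _ _)).
  replace (D k0 : C) with (Cplus (sum_n D (k0 + N))
    (Copp (Cminus (sum_n D (k0 + N)) (D k0)))) at 1 by ring.
  apply Cmod_triangle. }
nra.
Qed.

End LeadingTerm.

(** Since m^(-s-it) = m^(-it) m^(-s), the difference of the two zeta series is a Dirichlet series at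
    [s] with coefficients phi_n(m). *)
Lemma zeta_term_diff (t1 t2 d1 d2 : R) (sigma : positive -> positive) (s : C)
    (n : positive) (k : nat) :
  Cminus (zeta_term (Cplus s (Cmult Ci (RtoC (t1 + d1 * posR n)))) k)
    (zeta_term (Cplus s (Cmult Ci (RtoC (t2 + d2 * posR (sigma n))))) k) =
  Cmult (phi t1 t2 d1 d2 sigma n (Pos.of_succ_nat k)) (zeta_term s k).
Proof.
unfold zeta_term, phi.
rewrite !Copp_plus_distr, !pos_Cpow_plus; ring.
Qed.

Lemma Re_le_of_zeta_eq (t1 t2 d1 d2 : R) (sigma : positive -> positive) (s : C)
    (n mu : positive) :
  1 < Re s ->
  zeta (Cplus s (Cmult Ci (RtoC (t1 + d1 * posR n)))) =
  zeta (Cplus s (Cmult Ci (RtoC (t2 + d2 * posR (sigma n))))) ->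
  is_mu (phi t1 t2 d1 d2 sigma n) mu ->
  Re s <= 1 + 2 * posR mu / Cmod (phi t1 t2 d1 d2 sigma n mu).
Proof.
intros Hs Hz [Hmu Hmin].
set (s1 := Cplus s (Cmult Ci (RtoC (t1 + d1 * posR n)))) in *.
set (s2 := Cplus s (Cmult Ci (RtoC (t2 + d2 * posR (sigma n))))) in *.
assert (R1 : Re s1 = Re s) by apply Re_plus_Ci.
assert (R2 : Re s2 = Re s) by apply Re_plus_Ci.
set (D := fun k => Cminus (zeta_term s1 k) (zeta_term s2 k)).
assert (ED : forall k, D k =
  Cmult (phi t1 t2 d1 d2 sigma n (Pos.of_succ_nat k)) (zeta_term s k))
  by (intros k; apply zeta_term_diff).
(* Series indices start at 0: the term of index k belongs to the integer k + 1. *)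
set (k0 := pred (Pos.to_nat mu)).
assert (Ek0 : Pos.of_succ_nat k0 = mu)
  by (unfold k0; pose proof (Pos2Nat.is_pos mu); lia).
assert (HL : Cmod (D k0) <=
             2 / (Re s - 1) * Rpower (INR k0 + 1) (- (Re s - 1))).
{ apply leading_term_le; [exact Hs | lra | | |].
  (* The constant 2 arises here: imaginary shifts preserve the modulus, so both zeta terms have
     modulus (k+1)^(-Re s). *)
  - intros k; unfold D, Cminus.
    eapply Rle_trans; [apply Cmod_triangle|].
    rewrite Cmod_opp, !Cmod_zeta_term, R1, R2; lra.
  (* Indices below [k0] correspond to integers below [mu], where minimality of [mu] makes [phi]
     vanish. *)
  - intros k Hk; rewrite ED.
    destruct (Ceq_dec (phi t1 t2 d1 d2 sigma n (Pos.of_succ_nat k)) (RtoC 0))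
      as [E|E].
    + rewrite E; apply Cmult_0_l.
    + apply Hmin in E; lia.
  - replace (zero : C_NormedModule)
      with (minus (zeta s1 : C_NormedModule) (zeta s2))
      by (rewrite Hz; exact (minus_eq_zero (G := C_NormedModule) (zeta s2))).
    apply (is_series_minus (V := C_NormedModule));
      apply zeta_is_series; lra. }
rewrite ED, Cmod_mult, Cmod_zeta_term, Ek0, <- posR_of_succ_nat, Ek0 in HL.
assert (Pm : 0 < posR mu) by (unfold posR; apply IZR_lt; lia).
assert (Pphi := proj1 (Cmod_gt_0 _) Hmu).
set (F := Cmod (phi t1 t2 d1 d2 sigma n mu)) in *.
(* Splitting the exponent exposes the factor mu^(-Re s) common to both sides, which is then
   cancelled. *)
replace (- (Re s - 1)) with (- Re s + 1) in HL by ring.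
rewrite Rpower_plus, Rpower_1 in HL by exact Pm.
assert (PW : 0 < Rpower (posR mu) (- Re s)) by apply exp_pos.
assert (HF : F <= 2 / (Re s - 1) * posR mu).
{ apply Rmult_le_reg_r with (1 := PW); lra. }
apply (Rmult_le_compat_r ((Re s - 1) / F)) in HF.
- replace (F * ((Re s - 1) / F)) with (Re s - 1) in HF by (field; lra).
  replace (2 / (Re s - 1) * posR mu * ((Re s - 1) / F))
    with (2 * posR mu / F) in HF by (field; lra).
  lra.
- left; apply Rdiv_lt_0_compat; lra.
Qed.

Theorem theorem1 (t1 t2 d1 d2 : R) (sigma : positive -> positive) (s : C)
  (hd1 : 0 < d1) (hd2 : 0 < d2)
  (hsigma : Bijective sigma)
  (hs : 1 < Re s)
  (hzeta : forall n : positive,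
     zeta (Cplus s (Cmult Ci (RtoC (t1 + d1 * posR n)))) =
     zeta (Cplus s (Cmult Ci (RtoC (t2 + d2 * posR (sigma n)))))) :
  (t1 = t2 /\ d1 = d2 /\ forall n : positive, sigma n = n) \/
  Rbar_le (Finite (Re s)) (b_const t1 t2 d1 d2 sigma).
Proof.
(* It suffices that [Re s] is a lower bound of [b_set]; this covers the empty set, whose infimum is
   +oo. *)
right; apply (proj2 (Glb_Rbar_correct (b_set t1 t2 d1 d2 sigma))).
intros x [n [mu [Hmu ->]]].
exact (Re_le_of_zeta_eq t1 t2 d1 d2 sigma s n mu hs (hzeta n) Hmu).
Qed.
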